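(* Let $\sigma$ be an irreducible Pisot substitution on $\mathcal A$. Then the maps $E_1^*:\Psi(Z)\times\mathcal A\to2^{\Psi(Z)\times\mathcal A}$ and $T_{\rm ext}^{-1}:K_\alpha\times\mathcal A\to2^{K_\alpha\times\mathcal A}$ satisfy $$F\circ E_1^*=T_{\rm ext}^{-1}\circ F\quad\text{on }\Psi(Z)\times\mathcal A,$$ where by convention $F[\mathbf x,a]^*=(F(\mathbf x),a)$ and $F$ is applied to sets elementwise.
   Context: A substitution on $\mathcal A=\{1,\dots,n\}$ is an endomorphism $\sigma$ of the free monoid $\mathcal A^*$ such that the image of each letter is non-empty and $|\sigma^k(b)|\to\infty$ for at least one letter $b$. $\mathbf P(w)=(|w|_1,\dots,|w|_n)^t$; $M_\sigma$ has entries $(M_\sigma)_{a,b}=|\sigma(b)|_a$. $\sigma$ is an irreducible Pisot substitution if $M_\sigma$ is primitive with characteristic polynomial irreducible over $\mathbb Q$ and its dominant eigenvalue $\alpha$ is a Pisot number (algebraic integer $>1$ all of whose other conjugates have modulus $<1$; not necessarily a unit). The prefix automaton has vertex set $\mathcal A$ and an edge $b\xrightarrow{p}a$ whenever $\sigma(b)=pas$ for some $p,s\in\mathcal A^*$. $K=\mathbb Q(\alpha)$; $S_\alpha$ is the set of primes (places) of $K$ that are infinite or are finite and divide $(\alpha)$; $K_\infty=\prod_{\mathfrak p\mid\infty}K_{\mathfrak p}$, $K_\alpha=\prod_{\mathfrak p\in S_\alpha}K_{\mathfrak p}$ (products of completions); $\Phi:K\to K_\alpha$, $\Phi_\infty:K\to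 K_\infty$ are the diagonal embeddings; $K$ acts on $K_\alpha$ by coordinatewise multiplication. $\mathbf v_\alpha=(v_1,\dots,v_n)$ is a left eigenvector of $M_\sigma$ for $\alpha$ with entries in $\mathbb Q(\alpha)$; $\delta(w)=\langle\mathbf P(w),\mathbf v_\alpha\rangle$. $T_{\rm ext}^{-1}(\gamma,a)=\bigcup_{b\xrightarrow{p}a}\{(\alpha^{-1}(\gamma+\Phi(\delta(p))),b)\}$ for $(\gamma,a)\in K_\alpha\times\mathcal A$. $Z=\bigcup_{k\ge0}M_\sigma^{-k}\mathbb Z^n$, $Z_{\rm ext}=Z\times\prod_{\mathfrak p\mid(\alpha)}K_{\mathfrak p}$, $\Psi:Z\to Z_{\rm ext}$, $\Psi(\mathbf x)=(\mathbf x,\langle\mathbf x,\mathbf v_\alpha\rangle,\dots,\langle\mathbf x,\mathbf v_\alpha\rangle)$. $M_\sigma$ acts on $Z_{\rm ext}$ as $M_\sigma$ on $Z$ and as multiplication by $\alpha$ on each $K_{\mathfrak p}$, $\mathfrak p\mid(\alpha)$. Elements of $\Psi(Z)\times\mathcal A$ are written $[\mathbf z,a]^*$, and $E_1^*[\mathbf z,a]^*=\bigcup_{b\xrightarrow{p}a}\{[M_\sigma^{-1}(\mathbf z+\Psi(\mathbf P(p))),b]^*\}$. $F:Z_{\rm ext}\to K_\alpha$ is $F(\mathbf x,\mathbf y)=\big(\sum_i x_i\Phi_\infty(v_i),\mathbf y\big)$ for $\mathbf x=(x_1,\dots,x_n)^t\in Z$, $\mathbf y\in\prod_{\mathfrak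 p\mid(\alpha)}K_{\mathfrak p}$. *)

(* Defs.v *)
From HB Require Import structures.
From mathcomp Require Import all_boot all_order all_algebra all_field.
From mathcomp Require Import generic_quotient ring_quotient.
From mathcomp Require Import ring.
From mathcomp Require Import all_classical all_reals all_analysis.

Set Implicit Arguments.
Unset Strict Implicit.
Unset Printing Implicit Defensive.

Import Order.TTheory GRing.Theory Num.Theory.

Local Open Scope classical_set_scope.
Local Open Scope quotient_scope.
Local Open Scope ring_scope.

Record absval (R : realType) (K : fieldType) := AbsVal {
  av_fun :> K -> R;
  av_ge0 : forall x, 0 <= av_fun x;
  av_eq0 : forall x, (av_fun x == 0) = (x == 0);
  avM : forall x y, av_fun (x * y) = av_fun x * av_fun y;
  avD : forall x y, av_fun (x + y) <= av_fun x + av_fun y;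
  av_nontrivial : exists2 x, x != 0 & av_fun x != 1
}.

HB.instance Definition _ (R : realType) (K : fieldType) :=
  gen_eqMixin (absval R K).
HB.instance Definition _ (R : realType) (K : fieldType) :=
  gen_choiceMixin (absval R K).

Section AbsvalTheory.
Variables (R : realType) (K : fieldType).
Implicit Types v w : absval R K.

Lemma av0 v : v 0 = 0.
Proof. by apply/eqP; rewrite av_eq0. Qed.

Lemma av1 v : v 1 = 1.
Proof.
have n0 : v 1 != 0 by rewrite av_eq0 oner_eq0.
by apply: (mulfI n0); rewrite -avM !mulr1.
Qed.

Lemma avN v x : v (- x) = v x.
Proof.
have : v (-1) ^+ 2 = 1 by rewrite expr2 -avM mulrNN mulr1 av1.
move/eqP; rewrite sqrf_eq1 => /orP[] /eqP h.
  by rewrite -mulN1r avM h mul1r.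
by have := av_ge0 v (-1); rewrite h lerNr oppr0 ler10.
Qed.

Lemma av_gt0 v x : x != 0 -> 0 < v x.
Proof. by move=> x0; rewrite lt_def av_eq0 x0 av_ge0. Qed.

Lemma avV v x : v x^-1 = (v x)^-1.
Proof.
have [->|x0] := eqVneq x 0; first by rewrite invr0 av0 invr0.
have n0 : v x != 0 by rewrite av_eq0.
by apply: (mulfI n0); rewrite -avM !mulfV // av1.
Qed.

Lemma avB v x y : v (x - y) = v (y - x).
Proof. by rewrite -avN opprB. Qed.

Definition av_equiv_prop v w :=
  exists2 s : R, 0 < s & forall x, w x = v x `^ s.

Definition av_equiv v w := `[< av_equiv_prop v w >].

Lemma av_equiv_refl : reflexive av_equiv.
Proof.
by move=> v; apply/asboolP; exists 1 => // x; rewrite powRr1 ?av_ge0.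
Qed.

Lemma av_equiv_impl v w : av_equiv v w -> av_equiv w v.
Proof.
move/asboolP=> [s s0 h]; apply/asboolP; exists s^-1; first by rewrite invr_gt0.
by move=> x; rewrite h -powRrM mulfV ?gt_eqF // powRr1 ?av_ge0.
Qed.

Lemma av_equiv_sym : symmetric av_equiv.
Proof. by move=> v w; apply/idP/idP; apply: av_equiv_impl. Qed.

Lemma av_equiv_trans : transitive av_equiv.
Proof.
move=> w v u /asboolP[s s0 h] /asboolP[t t0 k]; apply/asboolP.
exists (s * t); first exact: mulr_gt0.
by move=> x; rewrite k h powRrM.
Qed.

Canonical av_equiv_rel :=
  EquivRel av_equiv av_equiv_refl av_equiv_sym av_equiv_trans.

(* A place is a class of nontrivial absolute values modulo v ~ v^s, s > 0. *)
Definition place := {eq_quot av_equiv}.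

End AbsvalTheory.
Arguments place : clear implicits.

Section Completion.
Variables (R : realType) (K : fieldType) (v : absval R K).
Implicit Types u : nat -> K.

Definition av_cauchy u := forall e : R, 0 < e ->
  exists N, forall i j, (N <= i)%N -> (N <= j)%N -> v (u i - u j) < e.

Definition av_null u := forall e : R, 0 < e ->
  exists N, forall i, (N <= i)%N -> v (u i) < e.

Definition cauchy_pred : {pred nat -> K} := fun u => `[< av_cauchy u >].

Lemma av_cauchy_bounded u : av_cauchy u ->
  exists2 B : R, 0 < B & exists N, forall i, (N <= i)%N -> v (u i) <= B.
Proof.
move=> /(_ 1 ltr01)[N hN]; exists (v (u N) + 1).
  by rewrite ltr_wpDl ?av_ge0.
exists N => i Ni; rewrite -(subrK (u N) (u i)) addrC.
by apply: (le_trans (avD _ _ _)); rewrite lerD2l ltW // hN.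
Qed.

Lemma av_cauchyB u w : av_cauchy u -> av_cauchy w -> av_cauchy (u - w).
Proof.
move=> cu cw e e0; have e20 : 0 < e / 2 by rewrite divr_gt0.
have [N hN] := cu _ e20; have [M hM] := cw _ e20.
exists (maxn N M) => i j; rewrite !geq_max => /andP[Ni Mi] /andP[Nj Mj].
have -> : (u - w) i - (u - w) j = (u i - u j) + (w j - w i).
  by rewrite -[(u - w) i]/(u i - w i) -[(u - w) j]/(u j - w j); ring.
apply: (le_lt_trans (avD _ _ _)); rewrite [e]splitr ltrD ?hN //.
exact: hM.
Qed.

Lemma av_cauchyM u w : av_cauchy u -> av_cauchy w -> av_cauchy (u * w).
Proof.
move=> cu cw e e0.
have [B B0 [N1 hB]] := av_cauchy_bounded cu.
have [C C0 [N2 hC]] := av_cauchy_bounded cw.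
have eC : 0 < e / 2 / C by rewrite !divr_gt0.
have eB : 0 < e / 2 / B by rewrite !divr_gt0.
have [N3 h3] := cu _ eC; have [N4 h4] := cw _ eB.
exists (maxn (maxn N1 N2) (maxn N3 N4)) => i j.
rewrite !geq_max => /andP[/andP[i1 i2] /andP[i3 i4]].
move=> /andP[/andP[j1 j2] /andP[j3 j4]].
have -> : (u * w) i - (u * w) j = (u i - u j) * w i + u j * (w i - w j).
  by rewrite -[(u * w) i]/(u i * w i) -[(u * w) j]/(u j * w j); ring.
apply: (le_lt_trans (avD _ _ _)); rewrite !avM [e]splitr ltr_leD //.
  apply: (le_lt_trans (ler_wpM2l (av_ge0 _ _) (hC _ i2))).
  by rewrite -ltr_pdivlMr // h3.
apply: (le_trans (ler_wpM2r (av_ge0 _ _) (hB _ j1))).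
by rewrite mulrC -ler_pdivlMr // ltW // h4.
Qed.

Lemma av_cauchy_cst x : av_cauchy (cst x).
Proof. by move=> e e0; exists 0%N => i j _ _; rewrite subrr av0. Qed.

Lemma cauchy_subring : subring_closed cauchy_pred.
Proof.
split=> [|x y /asboolP cx /asboolP cy|x y /asboolP cx /asboolP cy].
- exact/asboolP/(av_cauchy_cst 1).
- exact/asboolP/av_cauchyB.
- exact/asboolP/av_cauchyM.
Qed.

HB.instance Definition _ :=
  GRing.isSubringClosed.Build (nat -> K) cauchy_pred cauchy_subring.

Record cauchy_seq := CauchySeq {
  cauchy_val :> nat -> K;
  _ : cauchy_val \in cauchy_pred }.

HB.instance Definition _ := [isSub for cauchy_val].
HB.instance Definition _ := [Choice of cauchy_seq by <:].
HB.instance Definition _ :=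
  [SubChoice_isSubComNzRing of cauchy_seq by <:].

Definition null_pred : {pred cauchy_seq} := fun x => `[< av_null (val x) >].

Lemma null_idealr : idealr_closed null_pred.
Proof.
split.
- apply/asboolP => e e0; exists 0%N => i _.
  by rewrite rmorph0 /= av0.
- apply/negP => /asboolP /(_ 1 ltr01)[N /(_ _ (leqnn N))].
  by rewrite rmorph1 /= av1 ltxx.
move=> a u w /asboolP hu /asboolP hw; apply/asboolP => e e0.
have /asboolP ca := valP a.
have [B B0 [N1 hB]] := av_cauchy_bounded ca.
have e20 : 0 < e / 2 by rewrite divr_gt0.
have eB : 0 < e / 2 / B by rewrite !divr_gt0.
have [N2 h2] := hu _ eB; have [N3 h3] := hw _ e20.
exists (maxn N1 (maxn N2 N3)) => i.
rewrite !geq_max => /andP[i1 /andP[i2 i3]].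
rewrite rmorphD rmorphM /=.
apply: (le_lt_trans (avD _ _ _)); rewrite avM [e]splitr ler_ltD ?h3 //.
apply: (le_trans (ler_wpM2r (av_ge0 _ _) (hB _ i1))).
by rewrite mulrC -ler_pdivlMr // ltW // h2.
Qed.

HB.instance Definition _ := isIdealr.Build cauchy_seq null_pred null_idealr.

Lemma av_cauchy_nonnull u : av_cauchy u -> ~ av_null u ->
  exists2 c : R, 0 < c & exists N, forall i, (N <= i)%N -> c <= v (u i).
Proof.
move=> cu; apply: contra_notP => h e e0.
have e20 : 0 < e / 2 by rewrite divr_gt0.
have [N hN] := cu _ e20; exists N => i Ni.
rewrite ltNge; apply/negP => ei; apply: h; exists (e / 2) => //.
exists N => j Nj; rewrite -(lerD2l (e / 2)) -splitr.
apply: (le_trans ei); rewrite -{1}(subrK (u j) (u i)).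
by apply: (le_trans (avD _ _ _)); rewrite lerD2r ltW // hN.
Qed.

Lemma av_cauchyV u : av_cauchy u -> ~ av_null u ->
  av_cauchy (fun i => (u i)^-1).
Proof.
move=> cu nu e e0; have [c c0 [N1 hc]] := av_cauchy_nonnull cu nu.
have ec : 0 < e * (c * c) by rewrite !mulr_gt0.
have [N2 h2] := cu _ ec; exists (maxn N1 N2) => i j.
rewrite !geq_max => /andP[i1 i2] /andP[j1 j2].
have vi := lt_le_trans c0 (hc _ i1); have vj := lt_le_trans c0 (hc _ j1).
have ui : u i != 0 by rewrite -(av_eq0 v) gt_eqF.
have uj : u j != 0 by rewrite -(av_eq0 v) gt_eqF.
have -> : (u i)^-1 - (u j)^-1 = (u j - u i) / (u i * u j).
  by field; rewrite ui uj.
rewrite avM avV avM ltr_pdivrMr ?mulr_gt0 //.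
apply: (lt_le_trans (h2 _ _ j2 i2)).
by rewrite ler_pM2l // ler_pM ?hc // ltW.
Qed.

(* Cauchy sequences modulo null sequences. *)
Definition completion := {ideal_quot null_pred}.

HB.instance Definition _ := GRing.ComNzRing.on completion.

Lemma completion_invertible (x : completion) : x != 0 ->
  exists y, y * x = 1.
Proof.
rewrite -[x]reprK; set u := repr x => x0.
have nu : ~ av_null (val u).
  move=> h; case/negP: x0; rewrite piE Quotient.equivE subr0.
  exact/asboolP.
have cu : av_cauchy (val u) by exact/asboolP/(valP u).
have [c c0 [N hc]] := av_cauchy_nonnull cu nu.
have cw : (fun i => (val u i)^-1) \in cauchy_pred by exact/asboolP/av_cauchyV.
exists (\pi_completion (CauchySeq cw)).
apply/eqP; rewrite piE /= Quotient.equivE; apply/asboolP => e e0.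
exists N => i Ni; rewrite rmorphB rmorphM rmorph1 /=.
rewrite -[X in v X]/((val u i)^-1 * val u i - 1) mulVf ?subrr ?av0 //.
by rewrite -(av_eq0 v) gt_eqF // (lt_le_trans c0) // hc.
Qed.


Definition completion_inv (x : completion) : completion :=
  match pselect (x != 0) with
  | left x0 => sval (cid (completion_invertible x0))
  | right _ => 0
  end.

Lemma completion_mulVf x : x != 0 -> completion_inv x * x = 1.
Proof. by rewrite /completion_inv; case: pselect => // x0; case: cid. Qed.

Lemma completion_inv0 : completion_inv 0 = 0.
Proof. by rewrite /completion_inv; case: pselect => // h; exfalso; move: h; rewrite eqxx. Qed.

HB.instance Definition _ := GRing.ComNzRing_isField.Build completion
  completion_mulVf completion_inv0.

Lemma cst_cauchy (x : K) : cst x \in cauchy_pred.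
Proof. exact/asboolP/av_cauchy_cst. Qed.

Definition embed (x : K) : completion := \pi_completion (CauchySeq (cst_cauchy x)).

Lemma embed_zmod : zmod_morphism embed.
Proof.
move=> x y; rewrite /embed; apply/esym/(etrans (esym (raddfB \pi_completion _ _))).
by congr (\pi_completion _); exact: val_inj.
Qed.

Lemma embed_monoid : monoid_morphism embed.
Proof.
split=> [|x y]; rewrite /embed.
  apply: (etrans _ (rmorph1 \pi_completion)).
  by congr (\pi_completion _); exact: val_inj.
apply/esym/(etrans (esym (rmorphM \pi_completion _ _))).
by congr (\pi_completion _); exact: val_inj.
Qed.

HB.instance Definition _ := GRing.isZmodMorphism.Build K completion embed
  embed_zmod.
HB.instance Definition _ := GRing.isMonoidMorphism.Build K completion embed
  embed_monoid.

End Completion.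

Section Places.
Variables (R : realType) (K : fieldType).
Implicit Types (I J : set K).

Definition nonarchimedean (v : absval R K) :=
  forall x y, v (x + y) <= Num.max (v x) (v y).

(* Finite places are the non-archimedean ones; equivalent absolute values are
   simultaneously non-archimedean, so the choice of repr is immaterial. *)
Definition finite_place (p : place R K) := nonarchimedean (repr p).

Definition infinite_place (p : place R K) := ~ finite_place p.

Definition ring_of_integers : set K :=
  [set x | integralOver (intr : int -> K) x].

Definition integral_ideal I :=
  [/\ I `<=` ring_of_integers, I 0,
      (forall x y, I x -> I y -> I (x + y)) &
      (forall a x, ring_of_integers a -> I x -> I (a * x))].

Definition ideal_mul I J : set K :=
  [set z | exists m (x y : 'I_m -> K),
    [/\ (forall i, I (x i)), (forall i, J (y i)) & z = \sum_i x i * y i]].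

Definition ideal_dvd I J :=
  exists2 I', integral_ideal I' & J = ideal_mul I I'.

Definition principal_ideal (a : K) : set K :=
  [set a * x | x in ring_of_integers].

(* For a finite place this is the prime ideal of the ring of integers attached
   to it; it does not depend on the representative chosen by repr. *)
Definition prime_of_place (p : place R K) : set K :=
  [set x | ring_of_integers x /\ repr p x < 1].

Definition infinite_places : set (place R K) := [set p | infinite_place p].

Definition places_dividing (a : K) : set (place R K) :=
  [set p | finite_place p /\ ideal_dvd (prime_of_place p) (principal_ideal a)].

Definition S_places (a : K) : set (place R K) := infinite_places `|` places_dividing a.

Definition Kprod (D : set (place R K)) := forall p : D, completion (repr (val p)).

Section KprodTheory.
Variable D : set (place R K).

HB.instance Definition _ := gen_eqMixin (Kprod D).
HB.instance Definition _ := gen_choiceMixin (Kprod D).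

Definition kp_zero : Kprod D := fun=> 0.
Definition kp_opp (x : Kprod D) : Kprod D := fun p => - x p.
Definition kp_add (x y : Kprod D) : Kprod D := fun p => x p + y p.
Definition kp_scale (a : K) (x : Kprod D) : Kprod D := fun p => embed _ a * x p.

Lemma kp_addA : associative kp_add.
Proof. by move=> x y z; apply/functional_extensionality_dep => p; exact: addrA. Qed.
Lemma kp_addC : commutative kp_add.
Proof. by move=> x y; apply/functional_extensionality_dep => p; exact: addrC. Qed.
Lemma kp_add0 : left_id kp_zero kp_add.
Proof. by move=> x; apply/functional_extensionality_dep => p; exact: add0r. Qed.
Lemma kp_addN : left_inverse kp_zero kp_opp kp_add.
Proof. by move=> x; apply/functional_extensionality_dep => p; exact: addNr. Qed.

HB.instance Definition _ :=
  GRing.isZmodule.Build (Kprod D) kp_addA kp_addC kp_add0 kp_addN.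

Lemma kp_scaleA a b x : kp_scale a (kp_scale b x) = kp_scale (a * b) x.
Proof.
by apply/functional_extensionality_dep => p; rewrite /kp_scale rmorphM mulrA.
Qed.
Lemma kp_scale1 : left_id 1 kp_scale.
Proof.
by move=> x; apply/functional_extensionality_dep => p;
  rewrite /kp_scale rmorph1 mul1r.
Qed.
Lemma kp_scaleDr : right_distributive kp_scale +%R.
Proof.
by move=> a x y; apply/functional_extensionality_dep => p; exact: mulrDr.
Qed.
Lemma kp_scaleDl x : {morph kp_scale^~ x : a b / a + b}.
Proof.
move=> a b; apply/functional_extensionality_dep => p.
by rewrite /kp_scale rmorphD; exact: mulrDl.
Qed.

HB.instance Definition _ := GRing.Zmodule_isLmodule.Build K (Kprod D)
  kp_scaleA kp_scale1 kp_scaleDr kp_scaleDl.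

Definition Phi (a : K) : Kprod D := fun p => embed (repr (val p)) a.

End KprodTheory.

Lemma setU_valr (A B : set (place R K)) (p : A `|` B) :
  ~ A (val p) -> val p \in B.
Proof. by case: (set_mem (valP p)) => // h _; exact: mem_set. Qed.

(* The canonical identification of the product over a disjoint union A `|` B
   with the product of the products over A and over B. *)
Definition Kprod_glue (A B : set (place R K)) (x : Kprod A) (y : Kprod B) :
    Kprod (A `|` B) :=
  fun p => match pselect (A (val p)) with
  | left h => x (SigSub (mem_set h))
  | right h => y (SigSub (setU_valr h))
  end.

End Places.
Arguments infinite_places : clear implicits.
Arguments places_dividing R {K} a.
Arguments S_places R {K} a.
Arguments Phi {R K} D a.

(* Letters 1, ..., n are represented by 'I_n, and the free monoid by words
   in seq 'I_n. *)
Record substitution (n : nat) := Substitution {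
  subst_fun :> seq 'I_n -> seq 'I_n;
  subst_nil : subst_fun [::] = [::];
  subst_cat : {morph subst_fun : w1 w2 / w1 ++ w2};
  subst_nonempty : forall a, subst_fun [:: a] != [::];
  subst_growth : exists b, (fun k => size (iter k subst_fun [:: b])) @ \oo --> \oo
}.

Section Substitution.
Variables (n : nat) (sigma : substitution n).

Definition parikh (w : seq 'I_n) : 'cV[nat]_n := \col_a count_mem a w.

Definition incidence : 'M[nat]_n := \matrix_(a, b) count_mem a (sigma [:: b]).

Definition incidence_in (F : pzSemiRingType) : 'M[F]_n :=
  map_mx (fun m => m%:R) incidence.

(* The edge b --p--> a of the prefix automaton. *)
Definition prefix_edge (b : 'I_n) (p : seq 'I_n) (a : 'I_n) :=
  exists s, sigma [:: b] = p ++ [:: a] ++ s.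

End Substitution.

Definition primitive_matrix n (M : 'M[nat]_n) :=
  exists2 k, (0 < k)%N & forall i j, (0 < (M ^+ k) i j)%N.

Definition dominant_eigenvalue n (M : 'M[algC]_n) (a : algC) :=
  eigenvalue M a /\ forall b, eigenvalue M b -> b != a -> `|b| < `|a|.

Definition pisot_number (a : algC) :=
  [/\ a \in Aint, 1 < a &
      forall b, root (minCpoly a) b -> b != a -> `|b| < 1].

Definition irreducible_pisot (n : nat) (sigma : substitution n) :=
  [/\ primitive_matrix (incidence sigma),
      irreducible_poly (char_poly (incidence_in sigma rat)) &
      exists2 a, dominant_eigenvalue (incidence_in sigma algC) a & pisot_number a].

Section Zlattice.
Variables (n : nat) (sigma : substitution n).
Local Notation M := (incidence_in sigma rat).

(* The union over k of M^-k Z^n. For an irreducible Pisot substitution M is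
   invertible over Q, so that invmx M is its inverse. *)
Definition Zpred : {pred 'cV[rat]_n} := fun x =>
  `[< exists k (y : 'cV[int]_n), x = invmx M ^+ k *m map_mx intr y >].

Lemma Zpred_int (y : 'cV[int]_n) : map_mx intr y \in Zpred.
Proof. by apply/asboolP; exists 0%N, y; rewrite mul1mx. Qed.

Lemma Zpred_invmx x : x \in Zpred -> invmx M *m x \in Zpred.
Proof.
move=> /asboolP[k [y ->]]; apply/asboolP; exists k.+1, y.
by rewrite exprS mulmxA.
Qed.

Lemma incidence_exp_int k (y : 'cV[int]_n) :
  exists y' : 'cV[int]_n, M ^+ k *m map_mx intr y = map_mx intr y'.
Proof.
elim: k => [|k [y' IH]]; first by exists y; rewrite mul1mx.
exists (map_mx (fun m => m%:Z) (incidence sigma) *m y').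
rewrite exprS -mulmxA IH map_mxM; congr (_ *m _).
by apply/matrixP => i j; rewrite !mxE.
Qed.

Lemma Zpred_lift k l (y : 'cV[int]_n) : M \in unitmx ->
  exists y' : 'cV[int]_n,
    invmx M ^+ k *m map_mx intr y = invmx M ^+ (k + l) *m map_mx intr y'.
Proof.
move=> uM; have [y' hy'] := incidence_exp_int l y; exists y'.
rewrite -hy' exprD -mulmxA; congr (_ *m _).
elim: l {y' hy'} => [|l IH]; first by rewrite !mul1mx.
rewrite exprSr exprS -2!mulmxA [X in invmx M ^+ l *m X]mulmxA.
by rewrite [X in invmx M ^+ l *m X]mulmxA mulVmx // mul1mx.
Qed.

Lemma Zpred_zmod : zmod_closed Zpred.
Proof.
split; first by rewrite -(map_mx0 (intr : {rmorphism int -> rat})) Zpred_int.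
move=> x x' /asboolP[k [y ->]] /asboolP[l [z ->]].
have [uM|nM] := boolP (M \in unitmx).
  have [y' ->] := Zpred_lift k l y uM; have [z' ->] := Zpred_lift l k z uM.
  apply/asboolP; exists (k + l)%N, (y' - z').
  by rewrite [(l + k)%N]addnC map_mxB mulmxBr.
rewrite invmx_out //.
have [y' ->] := incidence_exp_int k y; have [z' ->] := incidence_exp_int l z.
by rewrite -map_mxB Zpred_int.
Qed.

HB.instance Definition _ := GRing.isZmodClosed.Build _ Zpred Zpred_zmod.

(* The additive group Z, as a subtype of Q^n. *)
Record Zgroup := ZGroup { Zval :> 'cV[rat]_n; _ : Zval \in Zpred }.

HB.instance Definition _ := [isSub for Zval].
HB.instance Definition _ := [Choice of Zgroup by <:].
HB.instance Definition _ := [SubChoice_isSubZmodule of Zgroup by <:].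

Definition Z_of_int (y : 'cV[int]_n) : Zgroup := ZGroup (Zpred_int y).

Definition Z_invM (x : Zgroup) : Zgroup := ZGroup (Zpred_invmx (valP x)).

End Zlattice.

Section Extended.
Variables (R : realType) (n : nat) (sigma : substitution n).
Variables (K : fieldExtType rat) (alpha : K) (v : 'rV[K]_n).

Definition pairing (x : 'cV[rat]_n) : K := \sum_i x i 0 *: v 0 i.

Definition parikh_Z (w : seq 'I_n) : Zgroup sigma :=
  Z_of_int sigma (map_mx Posz (parikh w)).

Definition delta (w : seq 'I_n) : K :=
  pairing (map_mx (fun m => m%:R) (parikh w)).

(* S_places is the disjoint union of the two index sets below, see Kprod_glue. *)
Definition K_alpha := Kprod (S_places R alpha).
Definition K_infty := Kprod (infinite_places R K).
Definition K_finite := Kprod (places_dividing R alpha).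

Definition Text_inv (x : K_alpha * 'I_n) : set (K_alpha * 'I_n) :=
  [set y | exists b p, prefix_edge sigma b p x.2 /\
     y = (alpha^-1 *: (x.1 + Phi _ (delta p)), b)].

Definition Zext := (Zgroup sigma * K_finite)%type.

Definition Psi (x : Zgroup sigma) : Zext := (x, Phi _ (pairing x)).

(* Inverse of the action of the incidence matrix on Zext. *)
Definition Zext_invM (z : Zext) : Zext := (Z_invM z.1, alpha^-1 *: z.2).

Definition E1star (x : Zext * 'I_n) : set (Zext * 'I_n) :=
  [set y | exists b p, prefix_edge sigma b p x.2 /\
     y = (Zext_invM (x.1 + Psi (parikh_Z p)), b)].

(* The rational scalars x_i act through the embedding of Q in K. *)
Definition F_ext (z : Zext) : K_alpha :=
  Kprod_glue (\sum_i (Zval z.1 i 0)%:A *: (Phi _ (v 0 i) : K_infty)) z.2.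

(* The convention F[x, a]* = (F(x), a). *)
Definition F_ext_letter (x : Zext * 'I_n) : K_alpha * 'I_n := (F_ext x.1, x.2).

End Extended.

(* Main.v *)
(** Everything reduces to two identities on [Z]. First, [F (Psi x) = Phi <x, v>],
    since the archimedean coordinates of [F] spell out [<x, v>] linearly. Second,
    [<M^-1 x, v> = alpha^-1 <x, v>], since [v] is a left eigenvector; here [M] is
    invertible because its characteristic polynomial is irreducible and has the
    root [alpha], which is nonzero, being the Pisot number itself. *)

Require Import Defs.
From HB Require Import structures.
From mathcomp Require Import all_boot all_order all_algebra all_field.
From mathcomp Require Import all_classical all_reals all_analysis.

Set Implicit Arguments.
Unset Strict Implicit.
Unset Printing Implicit Defensive.

Import Order.TTheory GRing.Theory Num.Theory.

Local Open Scope classical_set_scope.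
Local Open Scope ring_scope.

(** Two distinct ones would each have modulus strictly below the other. This identifies [iota alpha]
    with the Pisot number provided by [irreducible_pisot]. *)
Lemma dominant_eigenvalue_unique n (M : 'M[algC]_n) (a b : algC) :
  dominant_eigenvalue M a -> dominant_eigenvalue M b -> a = b.
Proof.
move=> [ea da] [eb db]; apply/eqP; apply: contraT => ab.
have lt_ba : `|b| < `|a| by rewrite da // eq_sym.
by have := lt_trans lt_ba (db _ ea ab); rewrite ltxx.
Qed.

(** If the determinant vanished, ['X] would divide the characteristic polynomial and, by
    irreducibility, be associated to it, leaving 0 as the only root. *)
Lemma irreducible_char_poly_unitmx (F L : fieldType) (f : {rmorphism F -> L})
    n (M : 'M[F]_n) (a : L) :
    irreducible_poly (char_poly M) -> a != 0 ->
    root (char_poly (map_mx f M)) a ->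
  M \in unitmx.
Proof.
move=> [_ irrM] a0 ra; rewrite unitmxE unitfE; apply/negP => /eqP dM.
have /irrM : 'X %| char_poly M.
  rewrite -['X]subr0 -polyC0 dvdp_XsubCl rootE horner_coef0 char_poly_det dM.
  by rewrite mulr0.
rewrite size_polyX => /(_ isT) eqX; case/negP: a0; move: ra.
rewrite -map_char_poly -(eqp_root (p := map_poly f 'X)); last by rewrite eqp_map.
by rewrite map_polyX rootX.
Qed.

Section Phi.
Variables (R : realType) (K : fieldType) (D : set (place R K)).

Lemma Phi_is_zmod_morphism : zmod_morphism (Phi D).
Proof. by move=> x y; apply/functional_extensionality_dep => p; exact: rmorphB. Qed.

HB.instance Definition _ :=
  GRing.isZmodMorphism.Build K (Kprod D) (Phi D) Phi_is_zmod_morphism.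

Lemma PhiM (x y : K) : Phi D (x * y) = x *: Phi D y.
Proof. by apply/functional_extensionality_dep => p; exact: rmorphM. Qed.

End Phi.

Lemma Kprod_glue_Phi (R : realType) (K : fieldType) (A B : set (place R K)) (x : K) :
  Kprod_glue (Phi A x) (Phi B x) = Phi (A `|` B) x.
Proof.
apply/functional_extensionality_dep => p.
by rewrite /Kprod_glue; case: pselect.
Qed.

Section Pairing.
Variables (n : nat) (sigma : substitution n) (K : fieldExtType rat) (v : 'rV[K]_n).
Local Notation M := (incidence_in sigma rat).

(** Recasting the pairing as a matrix product over [K] lets the eigenvector equation for [v] act on
    it. *)
Lemma pairingE (x : 'cV[rat]_n) : pairing v x = (v *m map_mx (in_alg K) x) 0 0.
Proof.
rewrite mxE; apply: eq_bigr => i _.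
by rewrite mxE /= mulr_algr.
Qed.

Lemma pairingD (x y : 'cV[rat]_n) : pairing v (x + y) = pairing v x + pairing v y.
Proof. by rewrite !pairingE map_mxD mulmxDr mxE. Qed.

Lemma incidence_in_alg : map_mx (in_alg K) M = incidence_in sigma K.
Proof. by apply/matrixP => i j; rewrite !mxE rmorph_nat. Qed.

Lemma pairing_invmx (alpha : K) (x : 'cV[rat]_n) :
    M \in unitmx -> alpha != 0 -> v *m incidence_in sigma K = alpha *: v ->
  pairing v (invmx M *m x) = alpha^-1 * pairing v x.
Proof.
move=> uM a0 vM; apply: (canRL (mulKf a0)).
(* After clearing [alpha^-1], only the right-hand [x] is expanded, as [M *m (invmx M *m x)], so that
   [v] meets [M]. *)
rewrite !pairingE -[x in RHS](mulKVmx uM) [in RHS]map_mxM mulmxA.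
by rewrite incidence_in_alg vM -scalemxAl [in RHS]mxE.
Qed.

Lemma pairing_parikh_Z (w : seq 'I_n) : pairing v (parikh_Z sigma w) = delta v w.
Proof. by congr pairing; apply/matrixP => i j; rewrite !mxE. Qed.

End Pairing.

Lemma irreducible_pisot_unit n (sigma : substitution n) (K : fieldExtType rat)
    (iota : {rmorphism K -> algC}) (alpha : K) :
  irreducible_pisot sigma ->
  dominant_eigenvalue (incidence_in sigma algC) (iota alpha) ->
  alpha != 0 /\ incidence_in sigma rat \in unitmx.
Proof.
move=> [_ irrM [a domA [_ a1 _]]] domi.
(* A Pisot number exceeds 1; nonvanishing then descends to [K] because field morphisms are
   injective. *)
have a0 : iota alpha != 0.
  by rewrite (dominant_eigenvalue_unique domi domA) gt_eqF // (lt_trans ltr01).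
split; first by rewrite -(fmorph_eq0 iota).
apply: (irreducible_char_poly_unitmx (f := ratr) irrM a0).
have -> : map_mx ratr (incidence_in sigma rat) = incidence_in sigma algC.
  by apply/matrixP => i j; rewrite !mxE rmorph_nat.
by case: domi; rewrite eigenvalue_root_char.
Qed.

Section Extended.
Variables (R : realType) (n : nat) (sigma : substitution n).
Variables (K : fieldExtType rat) (alpha : K) (v : 'rV[K]_n).

(** The finite coordinates agree by definition; the infinite ones follow from additivity of [Phi]
    and its compatibility with scalars. *)
Lemma F_ext_Psi (x : Zgroup sigma) :
  F_ext v (Psi R alpha v x) = Phi (S_places R alpha) (pairing v x).
Proof.
rewrite /F_ext /= -Kprod_glue_Phi; congr Kprod_glue.
rewrite /pairing raddf_sum; apply: eq_bigr => i _.
by rewrite -PhiM mulr_algl.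
Qed.

Lemma PsiD (x y : Zgroup sigma) :
  Psi R alpha v x + Psi R alpha v y = Psi R alpha v (x + y).
Proof. by rewrite /Psi pairingD raddfD. Qed.

Hypotheses (uM : incidence_in sigma rat \in unitmx) (alpha0 : alpha != 0).
Hypothesis vM : v *m incidence_in sigma K = alpha *: v.

Lemma Zext_invM_Psi (x : Zgroup sigma) :
  Zext_invM (Psi R alpha v x) = Psi R alpha v (Z_invM x).
Proof.
by rewrite /Zext_invM /Psi /= (pairing_invmx _ uM alpha0 vM) PhiM.
Qed.

(** This is the commutation along a single edge with prefix [p]. *)
Lemma F_ext_invM_Psi (x : Zgroup sigma) (p : seq 'I_n) :
  F_ext v (Zext_invM (Psi R alpha v x + Psi R alpha v (parikh_Z sigma p))) =
  alpha^-1 *: (F_ext v (Psi R alpha v x) + Phi _ (delta v p)).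
Proof.
rewrite PsiD Zext_invM_Psi !F_ext_Psi /= (pairing_invmx _ uM alpha0 vM) PhiM.
by rewrite pairingD (pairing_parikh_Z sigma) raddfD.
Qed.

End Extended.

Theorem lemma7p4 (R : realType) (n : nat) (sigma : substitution n)
    (K : fieldExtType rat) (iota : {rmorphism K -> algC}) (alpha : K)
    (v : 'rV[K]_n) :
  irreducible_pisot sigma ->
  dominant_eigenvalue (incidence_in sigma algC) (iota alpha) ->
  <<1; alpha>>%VS = fullv ->
  v != 0 ->
  v *m incidence_in sigma K = alpha *: v ->
  let PsiZ : set (Zext R sigma alpha) := range (Psi R alpha v) in
  (forall (z : Zext R sigma alpha) (a : 'I_n), PsiZ z ->
     E1star v (z, a) `<=` PsiZ `*` setT) /\
  (forall (z : Zext R sigma alpha) (a : 'I_n), PsiZ z ->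
     F_ext_letter v @` E1star v (z, a) =
     Text_inv sigma v (F_ext_letter v (z, a))).
Proof.
move=> irr dom _ _ vM PsiZ.
have [a0 uM] := irreducible_pisot_unit irr dom.
split=> _ a [x _ <-].
  move=> _ [b [p [_ ->]]]; split=> //=.
  by exists (Z_invM (x + parikh_Z sigma p)); rewrite // PsiD Zext_invM_Psi.
(* Both sets are indexed by the same edges into [a], so each inclusion reuses the pair [b], [p] of
   the given point. *)
apply/seteqP; split=> [_ [_ [b [p [e ->]]] <-]|_ [b [p [e ->]]]].
  by exists b, p; rewrite /F_ext_letter /= F_ext_invM_Psi.
exists (Zext_invM (Psi R alpha v x + Psi R alpha v (parikh_Z sigma p)), b).
  by exists b, p.
by rewrite /F_ext_letter /= F_ext_invM_Psi.
Qed.
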